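(* Let $m<M$ be real numbers and let $f:[m,M]\to\mathbb{R}$ be a convex function. Let $n\ge 1$ be an integer, let $a_1,\ldots,a_n\in[m,M]$, let $w_1,\ldots,w_n\in[0,1]$ with $\sum_{i=1}^n w_i=1$, and put $\overline{a}:=\sum_{i=1}^n w_i a_i$. Then $$\begin{aligned} f\left(M+m-\overline{a}\right)&\le \sum_{i=1}^{n} w_i f\left(M+m-\frac{\overline{a}+a_i}{2}\right)\\ &\le \sum_{i=1}^{n}\frac{w_i}{\overline{a}-a_i}\int_{M+m-\overline{a}}^{M+m-a_i} f(t)\,dt\\ &\le f(M)+f(m)-\sum_{i=1}^{n} w_i f(a_i).\end{aligned}$$
   Context: Integrals are oriented: $\int_x^y=-\int_y^x$ when $y<x$. For an index $i$ with $a_i=\overline{a}$, the quantity $\frac{1}{\overline{a}-a_i}\int_{M+m-\overline{a}}^{M+m-a_i} f(t)\,dt$ is understood as $f(M+m-\overline{a})$, i.e. as the value of $\int_0^1 f\left(M+m-\left(t\overline{a}+(1-t)a_i\right)\right)dt$, with which it coincides when $a_i\ne\overline{a}$. *)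

(* Defs.v *)
From Stdlib Require Import Reals.
From Coquelicot Require Import Coquelicot.
Open Scope R_scope.

(* The values of f outside [m, M] are irrelevant. *)
Definition convex_on (m M : R) (f : R -> R) : Prop :=
  forall x y t : R, m <= x <= M -> m <= y <= M -> 0 <= t <= 1 ->
    f (t * x + (1 - t) * y) <= t * f x + (1 - t) * f y.

(* 1 / (abar - ai) times the oriented integral of f from M + m - abar to
   M + m - ai. When ai = abar the quotient is read as the value of
   RInt (fun t => f (M + m - (t * abar + (1 - t) * ai))) 0 1, the integral
   of a constant. *)
Definition reflected_mean (f : R -> R) (m M abar ai : R) : R :=
  if Req_EM_T ai abar then f (M + m - abar)
  else 1 / (abar - ai) * RInt f (M + m - abar) (M + m - ai).

(* Main.v *)
Require Import Defs.
From Stdlib Require Import Reals Lra Lia.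
From Coquelicot Require Import Coquelicot.
Open Scope R_scope.

(** Put [p = M + m - abar] and [q = M + m - a i]. The [i]-th term of the third
    sum is the mean of [f] between [p] and [q], so the Hermite-Hadamard
    inequality places it between [f ((p + q) / 2)], which is the [i]-th term of
    the second sum, and [(f p + f q) / 2] ([reflected_mean_bounds]). This gives
    the middle inequality. The first one is [jensen], because the weighted mean
    of the points [M + m - (abar + a i) / 2] is [M + m - abar]. For the last
    one, [convex_reflect] on [m, M] gives
    [f (M + m - a i) <= f M + f m - f (a i)]; averaging this and applying
    [jensen] to the left-hand side gives Mercer's inequality
    [f (M + m - abar) <= f M + f m - sum of the w i * f (a i)]. These two bounds
    control the two halves of [(f p + f q) / 2].

    The integrals make sense because a convex function on a compact interval is
    Riemann integrable ([convex_ex_RInt]): it is continuous in the interior and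
    has one-sided limits at the endpoints, where it may jump. Both facts come
    from the monotonicity of chord slopes ([convex_slopes]). Hermite-Hadamard
    itself needs no supporting lines: the integral of [f t] over [p, q] equals
    that of [f (p + q - t)], and the sum of the two integrands is at least
    [2 * f ((p + q) / 2)] and at most [f p + f q]. *)

(** * Convexity *)

Lemma convex_on_sub (m M p q : R) (f : R -> R) :
  m <= p -> q <= M -> convex_on m M f -> convex_on p q f.
Proof. intros Hp Hq hf x y t Hx Hy; apply hf; lra. Qed.

Lemma convex_on_opp (c d : R) (f : R -> R) :
  convex_on c d f -> convex_on (- d) (- c) (fun x => f (- x)).
Proof.
intros hf x y t Hx Hy Ht.
replace (- (t * x + (1 - t) * y)) with (t * - x + (1 - t) * - y) by ring.
apply hf; lra.
Qed.

Lemma convex_mid (p q : R) (f : R -> R) :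
  p <= q -> convex_on p q f -> forall x y, p <= x <= q -> p <= y <= q ->
  2 * f ((x + y) / 2) <= f x + f y.
Proof.
intros Hpq hf x y Hx Hy.
assert (H := hf x y (1 / 2) Hx Hy ltac:(lra)).
replace (1 / 2 * x + (1 - 1 / 2) * y) with ((x + y) / 2) in H by field.
lra.
Qed.

(** The weights that express [t] by [p] and [q] are those that express
    [p + q - t] by [q] and [p], so the two chord bounds add up to a constant. *)
Lemma convex_reflect (p q : R) (f : R -> R) (t : R) :
  convex_on p q f -> p <= t <= q -> f t + f (p + q - t) <= f p + f q.
Proof.
intros hf Ht.
destruct (Req_dec p q) as [<- | Hne].
- replace t with p by lra. replace (p + p - p) with p by ring. lra.
- set (l := (q - t) / (q - p)).
  assert (El : t = l * p + (1 - l) * q) by (unfold l; field; lra).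
  assert (Hl : 0 <= l <= 1).
  { unfold l; split.
    - apply Rdiv_le_0_compat; lra.
    - apply Rle_div_l; lra. }
  assert (H1 := hf p q l ltac:(lra) ltac:(lra) Hl).
  assert (H2 := hf q p l ltac:(lra) ltac:(lra) Hl).
  rewrite <- El in H1.
  replace (l * q + (1 - l) * p) with (p + q - t) in H2 by (rewrite El; ring).
  lra.
Qed.

Definition slope (f : R -> R) (x y : R) : R := (f y - f x) / (y - x).

Lemma slope_spec (f : R -> R) (x y : R) :
  x < y -> f y - f x = slope f x y * (y - x).
Proof. intros H; unfold slope; field; lra. Qed.

Lemma convex_slopes (c d : R) (f : R -> R) (x y z : R) :
  convex_on c d f -> c <= x -> x < y -> y < z -> z <= d ->
  slope f x y <= slope f x z <= slope f y z.
Proof.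
intros hf Hx Hxy Hyz Hz.
assert (H : f y * (z - x) <= (z - y) * f x + (y - x) * f z).
{ assert (Ht : 0 <= (z - y) / (z - x) <= 1).
  { split.
    - apply Rdiv_le_0_compat; lra.
    - apply Rle_div_l; lra. }
  assert (H := hf x z _ ltac:(lra) ltac:(lra) Ht).
  replace ((z - y) / (z - x) * x + (1 - (z - y) / (z - x)) * z)
    with y in H by (field; lra).
  replace ((z - y) / (z - x) * f x + (1 - (z - y) / (z - x)) * f z)
    with (((z - y) * f x + (y - x) * f z) / (z - x)) in H by (field; lra).
  apply Rle_div_r in H; lra. }
assert (E1 := slope_spec f x y Hxy).
assert (E2 := slope_spec f y z Hyz).
assert (E3 := slope_spec f x z ltac:(lra)).
split.
- apply Rmult_le_reg_r with ((y - x) * (z - x)); [nra |].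
  replace (slope f x y * ((y - x) * (z - x)))
    with ((f y - f x) * (z - x)) by (rewrite E1; ring).
  replace (slope f x z * ((y - x) * (z - x)))
    with ((f z - f x) * (y - x)) by (rewrite E3; ring).
  lra.
- apply Rmult_le_reg_r with ((z - y) * (z - x)); [nra |].
  replace (slope f x z * ((z - y) * (z - x)))
    with ((f z - f x) * (z - y)) by (rewrite E3; ring).
  replace (slope f y z * ((z - y) * (z - x)))
    with ((f z - f y) * (z - x)) by (rewrite E2; ring).
  lra.
Qed.

(** * Integrability of convex functions *)

(** Around [x] every increment of [f] is controlled by the slopes of the two
    chords that join [x] to the endpoints, so [f] is Lipschitz at [x]. *)
Lemma convex_continuous_interior (c d : R) (f : R -> R) (x : R) :
  convex_on c d f -> c < x < d -> filterlim f (locally x) (locally (f x)).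
Proof.
intros hf Hx.
set (s1 := slope f c x); set (s2 := slope f x d).
assert (Hlip : forall y, c < y < d ->
  Rabs (f y - f x) <= (Rabs s1 + Rabs s2 + 1) * Rabs (y - x)).
{ intros y Hy.
  assert (A1 := Rle_abs s1); assert (A2 := Rle_abs s2).
  assert (A3 := Rle_abs (- s1)); assert (A4 := Rle_abs (- s2)).
  rewrite Rabs_Ropp in A3, A4.
  destruct (Rtotal_order x y) as [Hlt | [<- | Hgt]].
  - assert (B1 := convex_slopes c d f c x y hf ltac:(lra) ltac:(lra) Hlt ltac:(lra)).
    assert (B2 := convex_slopes c d f x y d hf ltac:(lra) Hlt ltac:(lra) ltac:(lra)).
    fold s1 in B1; fold s2 in B2.
    rewrite (slope_spec f x y Hlt), (Rabs_pos_eq (y - x)) by lra.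
    rewrite Rabs_mult, (Rabs_pos_eq (y - x)) by lra.
    apply Rmult_le_compat_r; [lra |].
    apply Rabs_le; lra.
  - rewrite !Rminus_diag, Rabs_R0; lra.
  - assert (B1 := convex_slopes c d f c y x hf ltac:(lra) ltac:(lra) Hgt ltac:(lra)).
    assert (B2 := convex_slopes c d f y x d hf ltac:(lra) Hgt ltac:(lra) ltac:(lra)).
    fold s1 in B1; fold s2 in B2.
    rewrite (Rabs_minus_sym (f y)), (Rabs_minus_sym y).
    rewrite (slope_spec f y x Hgt), (Rabs_pos_eq (x - y)) by lra.
    rewrite Rabs_mult, (Rabs_pos_eq (x - y)) by lra.
    apply Rmult_le_compat_r; [lra |].
    apply Rabs_le; lra. }
(* The summand 1 keeps the Lipschitz constant positive, for the division. *)
set (K := Rabs s1 + Rabs s2 + 1) in Hlip.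
assert (HK : 0 < K).
{ unfold K; assert (A1 := Rabs_pos s1); assert (A2 := Rabs_pos s2); lra. }
apply filterlim_locally; intros eps.
assert (Hdel : 0 < Rmin (eps / K) (Rmin (x - c) (d - x))).
{ repeat apply Rmin_pos; try lra. apply Rdiv_lt_0_compat; [apply cond_pos | exact HK]. }
exists (mkposreal _ Hdel); intros y Hy.
change (Rabs (y - x) < Rmin (eps / K) (Rmin (x - c) (d - x))) in Hy.
change (Rabs (f y - f x) < eps).
assert (H1 := Rlt_le_trans _ _ _ Hy (Rmin_l _ _)).
assert (H2 := Rlt_le_trans _ _ _ Hy (Rmin_r _ _)).
assert (H3 := Rlt_le_trans _ _ _ H2 (Rmin_l _ _)).
assert (H4 := Rlt_le_trans _ _ _ H2 (Rmin_r _ _)).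
apply Rabs_def2 in H3; apply Rabs_def2 in H4.
apply Rle_lt_trans with (1 := Hlip y ltac:(lra)).
apply Rlt_div_r in H1; [lra | exact HK].
Qed.

Lemma monotone_limit_right (c d B : R) (g : R -> R) :
  c < d -> (forall x, c < x < d -> B <= g x) ->
  (forall x y, c < x -> x < y -> y < d -> g x <= g y) ->
  exists l, filterlim g (at_right c) (locally l).
Proof.
intros Hcd HB Hmon.
(* The limit is the infimum of [g], obtained as a supremum of [- g]. *)
destruct (completeness (fun v => exists x, c < x < d /\ v = - g x))
  as [L [Hub Hlub]].
- exists (- B); intros v [x [Hx ->]]; generalize (HB x Hx); lra.
- exists (- g ((c + d) / 2)), ((c + d) / 2); lra.
- exists (- L). apply filterlim_locally; intros [eps Heps].
  assert (Hx0 : exists x0, c < x0 < d /\ g x0 < - L + eps).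
  { apply Classical_Prop.NNPP; intros Hno.
    assert (L <= L - eps); [| lra].
    apply Hlub; intros v [x [Hx ->]].
    destruct (Rlt_or_le (g x) (- L + eps)) as [Hlt | Hle]; [| lra].
    exfalso; apply Hno; exists x; tauto. }
  destruct Hx0 as [x0 [Hx0 Hg]].
  assert (Hp : 0 < x0 - c) by lra.
  exists (mkposreal _ Hp); intros x Hx Hcx.
  change (Rabs (x - c) < x0 - c) in Hx.
  change (Rabs (g x - - L) < eps).
  apply Rabs_def2 in Hx.
  assert (H1 := Hmon x x0 Hcx ltac:(lra) ltac:(lra)).
  assert (H2 : - g x <= L) by (apply Hub; exists x; split; [lra | reflexivity]).
  apply Rabs_def1; lra.
Qed.

(** The slope of the chord from [x] to [d] decreases as [x] decreases to [c],
    and the chord from [c] itself bounds it from below; [f] inherits the limit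
    of this slope, although it may jump at [c]. *)
Lemma convex_limit_right (c d : R) (f : R -> R) :
  c < d -> convex_on c d f -> exists l, filterlim f (at_right c) (locally l).
Proof.
intros Hcd hf.
destruct (monotone_limit_right c d (slope f c d) (fun x => slope f x d) Hcd)
  as [L HL].
- intros x Hx.
  apply (convex_slopes c d f c x d hf); lra.
- intros x y Hx Hxy Hy.
  apply (convex_slopes c d f x y d hf); lra.
- exists (plus (f d) (mult L (c - d))).
  apply filterlim_ext_loc with (fun x => plus (f d) (mult (slope f x d) (x - d))).
  + assert (Hp : 0 < d - c) by lra.
    exists (mkposreal _ Hp); intros x Hx Hcx.
    change (Rabs (x - c) < d - c) in Hx; apply Rabs_def2 in Hx.
    change (f d + slope f x d * (x - d) = f x).
    assert (E := slope_spec f x d ltac:(lra)). lra.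
  + apply @filterlim_comp_2 with (G := locally (f d)) (H := locally (mult L (c - d))).
    * typeclasses eauto.
    * apply filterlim_const.
    * apply @filterlim_comp_2 with (G := locally L) (H := locally (c - d)).
      -- typeclasses eauto.
      -- exact HL.
      -- apply (filterlim_filter_le_1 (F := locally c)).
         ++ apply filter_le_within; typeclasses eauto.
         ++ apply (continuous_minus (fun x : R => x) (fun _ => d)).
            ** apply continuous_id.
            ** apply continuous_const.
      -- apply (filterlim_mult (K := R_AbsRing)).
    * apply (filterlim_plus (V := R_NormedModule)).
Qed.

Lemma convex_limit_left (c d : R) (f : R -> R) :
  c < d -> convex_on c d f -> exists l, filterlim f (at_left d) (locally l).
Proof.
intros Hcd hf.
destruct (convex_limit_right (- d) (- c) (fun x => f (- x))) as [l Hl].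
- lra.
- now apply convex_on_opp.
- exists l.
  apply filterlim_ext with (fun x => f (- - x)).
  + intros x; now rewrite Ropp_involutive.
  + exact (filterlim_comp _ _ _ Ropp (fun x => f (- x)) _ _ _
      (filterlim_Ropp_left d) Hl).
Qed.

(** On the open interval [f] coincides with a function that is continuous
    everywhere, and the values at the two endpoints do not matter. *)
Lemma convex_ex_RInt (p q : R) (f : R -> R) :
  p < q -> convex_on p q f -> ex_RInt f p q.
Proof.
intros Hpq hf.
destruct (convex_limit_right p q f Hpq hf) as [lp Hlp].
destruct (convex_limit_left p q f Hpq hf) as [lq Hlq].
destruct (C0_extension_lt f lp lq p q Hpq
  (fun x Hx => convex_continuous_interior p q f x hf Hx) Hlp Hlq)
  as [g [Hg [Hfg _]]].
apply ex_RInt_ext with g.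
- intros x; rewrite Rmin_left, Rmax_right by lra; apply Hfg.
- apply (ex_RInt_continuous (V := R_CompleteNormedModule)); intros x _; apply Hg.
Qed.

(** * The Hermite-Hadamard inequality *)

(** Reflecting the interval preserves the integral, so twice the integral is
    that of [f t + f (p + q - t)], which lies between two constants. *)
Lemma hermite_hadamard_lt (p q : R) (f : R -> R) :
  p < q -> convex_on p q f ->
  (q - p) * (2 * f ((p + q) / 2)) <= 2 * RInt f p q
    <= (q - p) * (f p + f q).
Proof.
intros Hpq hf.
assert (Hex := convex_ex_RInt p q f Hpq hf).
assert (Hex' : ex_RInt f (-1 * p + (p + q)) (-1 * q + (p + q))).
{ replace (-1 * p + (p + q)) with q by ring.
  replace (-1 * q + (p + q)) with p by ring.
  now apply ex_RInt_swap. }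
assert (Hr : is_RInt (fun t => f (p + q - t)) p q (RInt f p q)).
{ assert (H := is_RInt_comp_lin f (-1) (p + q) p q _ (RInt_correct f _ _ Hex')).
  apply is_RInt_opp in H.
  replace (-1 * p + (p + q)) with q in H by ring.
  replace (-1 * q + (p + q)) with p in H by ring.
  rewrite <- (opp_RInt_swap f q p) by now apply ex_RInt_swap.
  revert H; apply is_RInt_ext; intros t _.
  change (- (-1 * f (-1 * t + (p + q))) = f (p + q - t)).
  replace (-1 * t + (p + q)) with (p + q - t) by ring; ring. }
assert (Hs := is_RInt_plus _ _ _ _ _ _ (RInt_correct f p q Hex) Hr).
change (is_RInt (fun t => f t + f (p + q - t)) p q (RInt f p q + RInt f p q)) in Hs.
rewrite Rplus_diag in Hs.
split.
- apply (is_RInt_le (fun _ => 2 * f ((p + q) / 2))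
    (fun t => f t + f (p + q - t)) p q); [lra | | exact Hs |].
  + apply (is_RInt_const (V := R_NormedModule)).
  + intros t Ht.
    replace ((p + q) / 2) with ((t + (p + q - t)) / 2) by field.
    apply (convex_mid p q f); trivial; lra.
- apply (is_RInt_le (fun t => f t + f (p + q - t))
    (fun _ => f p + f q) p q); [lra | exact Hs | |].
  + apply (is_RInt_const (V := R_NormedModule)).
  + intros t Ht; apply convex_reflect; trivial; lra.
Qed.

Lemma hermite_hadamard (m M p q : R) (f : R -> R) :
  convex_on m M f -> m <= p <= M -> m <= q <= M -> p <> q ->
  f ((p + q) / 2) <= 1 / (q - p) * RInt f p q <= (f p + f q) / 2.
Proof.
intros hf Hp Hq Hne.
assert (Hlt : forall u v, m <= u -> v <= M -> u < v ->
  f ((u + v) / 2) <= 1 / (v - u) * RInt f u v <= (f u + f v) / 2).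
{ intros u v Hu Hv Huv.
  assert (H := hermite_hadamard_lt u v f Huv (convex_on_sub m M u v f Hu Hv hf)).
  replace (1 / (v - u) * RInt f u v) with (RInt f u v / (v - u)) by (field; lra).
  split; [apply Rle_div_r | apply Rle_div_l]; lra. }
destruct (Rlt_or_le p q) as [H | H]; [apply Hlt; lra |].
assert (Hqp : q < p) by lra.
rewrite <- (opp_RInt_swap f q p) by
  (apply convex_ex_RInt; [lra | apply (convex_on_sub m M); trivial; lra]).
change (opp (RInt f q p)) with (- RInt f q p).
replace (1 / (q - p) * - RInt f q p) with (1 / (p - q) * RInt f q p)
  by (field; lra).
rewrite (Rplus_comm p q), (Rplus_comm (f p)).
apply Hlt; lra.
Qed.

Lemma reflected_mean_bounds (m M abar ai : R) (f : R -> R) :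
  convex_on m M f -> m <= abar <= M -> m <= ai <= M ->
  f (M + m - (abar + ai) / 2) <= reflected_mean f m M abar ai
    <= (f (M + m - abar) + f (M + m - ai)) / 2.
Proof.
intros hf Habar Hai; unfold reflected_mean.
destruct (Req_EM_T ai abar) as [-> | Hne].
- replace ((abar + abar) / 2) with abar by field; lra.
- assert (H := hermite_hadamard m M (M + m - abar) (M + m - ai) f hf
    ltac:(lra) ltac:(lra) ltac:(lra)).
  replace (M + m - ai - (M + m - abar)) with (abar - ai) in H by ring.
  replace ((M + m - abar + (M + m - ai)) / 2)
    with (M + m - (abar + ai) / 2) in H by field.
  exact H.
Qed.

(** * Weighted sums and Jensen's inequality *)

Lemma sum_1_S (u : nat -> R) (n : nat) :
  sum_n_m u 1 (S n) = sum_n_m u 1 n + u (S n).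
Proof. apply (sum_n_Sm u); lia. Qed.

Lemma sum_1_0 (u : nat -> R) : sum_n_m u 1 0 = 0.
Proof. apply (sum_n_m_zero u); lia. Qed.

Lemma weighted_sum_le (n : nat) (w u v : nat -> R) :
  (forall i, (1 <= i <= n)%nat -> 0 <= w i) ->
  (forall i, (1 <= i <= n)%nat -> u i <= v i) ->
  sum_n_m (fun i => w i * u i) 1 n <= sum_n_m (fun i => w i * v i) 1 n.
Proof.
induction n as [| n IH]; intros hw huv.
- rewrite !sum_1_0; lra.
- rewrite !sum_1_S; apply Rplus_le_compat.
  + apply IH; intros; [apply hw | apply huv]; lia.
  + apply Rmult_le_compat_l; [apply hw | apply huv]; lia.
Qed.

Lemma weighted_sum_affine (n : nat) (w u v : nat -> R) (al be : R) :
  (forall i, v i = al + be * u i) ->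
  (sum_n_m (fun i => w i * v i) 1 n : R) =
  al * sum_n_m w 1 n + be * sum_n_m (fun i => w i * u i) 1 n.
Proof.
intros Hv; induction n as [| n IH].
- rewrite !sum_1_0; ring.
- rewrite !sum_1_S, IH, Hv; ring.
Qed.

(** A barycentre [y] is carried along instead of a quotient by the total
    weight, so that the induction also passes through partial sums whose
    weights all vanish; there any point of the interval serves as [y]. *)
Lemma jensen_barycentre (m M : R) (f : R -> R) (n : nat) (w x : nat -> R) :
  m <= M -> convex_on m M f ->
  (forall i, (1 <= i <= n)%nat -> 0 <= w i) ->
  (forall i, (1 <= i <= n)%nat -> m <= x i <= M) ->
  0 <= sum_n_m w 1 n /\
  exists y, m <= y <= M /\
    sum_n_m w 1 n * y = sum_n_m (fun i => w i * x i) 1 n /\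
    sum_n_m w 1 n * f y <= sum_n_m (fun i => w i * f (x i)) 1 n.
Proof.
intros HmM hf; induction n as [| n IH]; intros hw hx.
- rewrite !sum_1_0; split; [lra |]; exists m; lra.
- destruct IH as [HW [y [Hy [Ey Hfy]]]];
    [intros; apply hw; lia | intros; apply hx; lia |].
  rewrite !sum_1_S, <- Ey.
  assert (Hwn := hw (S n) ltac:(lia)); assert (Hxn := hx (S n) ltac:(lia)).
  set (W := sum_n_m w 1 n) in *; set (v := w (S n)) in *;
    set (z := x (S n)) in *.
  split; [lra |].
  destruct (Req_dec (W + v) 0) as [H0 | H0].
  + exists y. replace v with 0 by lra. replace W with 0 in * by lra. lra.
  + set (t := W / (W + v)).
    assert (Et : (W + v) * t = W) by (unfold t; field; exact H0).
    assert (Ht : 0 <= t <= 1).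
    { unfold t; split.
      - apply Rdiv_le_0_compat; lra.
      - apply Rle_div_l; lra. }
    exists (t * y + (1 - t) * z); split; [nra |]; split.
    * replace ((W + v) * (t * y + (1 - t) * z))
        with ((W + v) * t * y + (W + v - (W + v) * t) * z) by ring.
      rewrite Et; ring.
    * assert (H := hf y z t Hy Hxn Ht).
      apply Rmult_le_compat_l with (r := W + v) in H; [| lra].
      replace ((W + v) * (t * f y + (1 - t) * f z))
        with ((W + v) * t * f y + (W + v - (W + v) * t) * f z) in H by ring.
      rewrite Et in H; lra.
Qed.

Lemma jensen (m M : R) (f : R -> R) (n : nat) (w x : nat -> R) :
  m <= M -> convex_on m M f ->
  (forall i, (1 <= i <= n)%nat -> 0 <= w i) ->
  (forall i, (1 <= i <= n)%nat -> m <= x i <= M) ->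
  sum_n_m w 1 n = 1 ->
  m <= sum_n_m (fun i => w i * x i) 1 n <= M /\
  f (sum_n_m (fun i => w i * x i) 1 n) <= sum_n_m (fun i => w i * f (x i)) 1 n.
Proof.
intros HmM hf hw hx hw1.
destruct (jensen_barycentre m M f n w x HmM hf hw hx) as [_ [y [Hy [Ey Hfy]]]].
rewrite hw1, Rmult_1_l in Ey, Hfy; subst y; tauto.
Qed.

(** * The refined Jensen-Mercer inequality *)

Theorem theorem2p2 (m M : R) (hmM : m < M)
    (f : R -> R) (hf : convex_on m M f)
    (n : nat) (hn : (1 <= n)%nat) (a w : nat -> R)
    (ha : forall i : nat, (1 <= i <= n)%nat -> m <= a i <= M)
    (hw : forall i : nat, (1 <= i <= n)%nat -> 0 <= w i <= 1)
    (hw1 : sum_n_m w 1 n = 1) :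
  let abar : R := sum_n_m (fun i => w i * a i) 1 n in
  f (M + m - abar)
    <= sum_n_m (fun i => w i * f (M + m - (abar + a i) / 2)) 1 n
  /\ sum_n_m (fun i => w i * f (M + m - (abar + a i) / 2)) 1 n
    <= sum_n_m (fun i => w i * reflected_mean f m M abar (a i)) 1 n
  /\ sum_n_m (fun i => w i * reflected_mean f m M abar (a i)) 1 n
    <= f M + f m - sum_n_m (fun i => w i * f (a i)) 1 n.
Proof.
intros abar.
assert (hw0 : forall i, (1 <= i <= n)%nat -> 0 <= w i) by (intros; now apply hw).
assert (Habar : m <= abar <= M)
  by (apply (jensen m M f n w a); trivial; lra).
split; [| split].
- assert (E : (sum_n_m (fun i => w i * (M + m - (abar + a i) / 2)) 1 n : R)
              = M + m - abar).
  { rewrite (weighted_sum_affine n w a _ (M + m - abar / 2) (- / 2))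
      by (intros i; field).
    rewrite hw1; fold abar; field. }
  rewrite <- E.
  apply (jensen m M f n w (fun i => M + m - (abar + a i) / 2)); trivial; [lra |].
  intros i Hi; generalize (ha i Hi); lra.
- apply weighted_sum_le; trivial.
  intros i Hi; apply reflected_mean_bounds; auto.
- assert (Hmercer : f (M + m - abar)
                    <= f M + f m - sum_n_m (fun i => w i * f (a i)) 1 n).
  { assert (E : (sum_n_m (fun i => w i * (M + m - a i)) 1 n : R) = M + m - abar).
    { rewrite (weighted_sum_affine n w a _ (M + m) (- 1))
        by (intros i; ring).
      rewrite hw1; fold abar; ring. }
    rewrite <- E.
    apply Rle_trans with (sum_n_m (fun i => w i * f (M + m - a i)) 1 n).
    - apply (jensen m M f n w (fun i => M + m - a i)); trivial; [lra |].
      intros i Hi; generalize (ha i Hi); lra.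
    - assert (E' := weighted_sum_affine n w (fun i => f (a i)) _
        (f M + f m) (- 1) (fun i => eq_refl)).
      rewrite hw1 in E'.
      replace (f M + f m - sum_n_m (fun i => w i * f (a i)) 1 n)
        with ((f M + f m) * 1 + - 1 * sum_n_m (fun i => w i * f (a i)) 1 n)
        by ring.
      rewrite <- E'.
      apply weighted_sum_le; trivial.
      intros i Hi.
      assert (H := convex_reflect m M f (a i) hf (ha i Hi)).
      rewrite (Rplus_comm m M) in H; lra. }
  (* The mean is at most half of f (M + m - abar) + f (M + m - a i); Mercer's
     inequality bounds the first half, reflection in [m, M] the second. *)
  set (F := sum_n_m (fun i => w i * f (a i)) 1 n) in *.
  assert (E := weighted_sum_affine n w (fun i => f (a i)) _
    (f M + f m - F / 2) (- / 2) (fun i => eq_refl)).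
  cbv beta in E; fold F in E; rewrite hw1 in E.
  replace (f M + f m - F) with ((f M + f m - F / 2) * 1 + - / 2 * F) by field.
  rewrite <- E.
  apply weighted_sum_le; trivial.
  intros i Hi.
  assert (H := convex_reflect m M f (a i) hf (ha i Hi)).
  rewrite (Rplus_comm m M) in H.
  assert (H' := reflected_mean_bounds m M abar (a i) f hf Habar (ha i Hi)).
  lra.
Qed.
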